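(* Let $n\ge 1$ be fixed. Assume that there exist a set $\mathcal{V}_n\subset \mathcal{S}_n^V$ and, for every $v\in\mathcal{V}_n$, a nonempty set $\mathcal{U}_n(v)\subset \mathcal{S}_n(v)$, and constants $\delta>0$, $k_o\in\mathbb{N}$ ($k_o\ge 1$) and $\psi_n\in\mathbb{R}$ such that: 1) for every $v\in\mathcal{V}_n$ and all $u_1,u_2\in\mathcal{U}_n(v)$ with $u_1<u_2$, $$l(u_2,v)-l(u_1,v)\ge \delta;$$ 2) for every $v\in\mathcal{V}_n$, $$\mathrm{Var}\big[U_{(v)}\,\big|\,U_{(v)}\in\mathcal{U}_n(v)\big]\ge \psi_n;$$ 3) for every $v\in\mathcal{V}_n$, any two consecutive elements of $\mathcal{U}_n(v)$ are at most $k_o$ apart, i.e. for every $u_1\in\mathcal{U}_n(v)$ which is not the largest element of $\mathcal{U}_n(v)$ there is $u_2\in\mathcal{U}_n(v)$ with $u_1<u_2\le u_1+k_o$. Then $$\mathrm{Var}[L(Z)]\ \ge\ \Big(\frac{\delta}{k_o}\Big)^2\,\psi_n\sum_{v\in\mathcal{V}_n}P\big(U_{(v)}\in\mathcal{U}_n(v)\big)\,P(V=v).$$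
   Context: Let $\mathbb{A}$ be a finite alphabet and $\mathcal{X}_n\subseteq\mathbb{A}^n$. $X=(X_1,\dots,X_n)$ and $Y=(Y_1,\dots,Y_n)$ are independent, identically distributed random sequences with sample space $\mathcal{X}_n$, and $Z:=(X,Y)$. Score: let $S:\mathbb{A}\times\mathbb{A}\to\mathbb{R}^+$ be a pairwise scoring function (nonnegative values) and $\gamma\in\mathbb{R}$ a gap price. An alignment is a pair $(\rho,\tau)$ of increasing integer sequences $1\le\rho_1<\dots<\rho_k\le n$, $1\le\tau_1<\dots<\tau_k\le n$ of the same length $k$ (with $0\le k\le n$). Its score is $U_{(\rho,\tau)}(X,Y)=\sum_{i=1}^kS(X_{\rho_i},Y_{\tau_i})+\gamma(n-k)$, and the optimal score is $L(Z)=L(X,Y)=\max_{(\rho,\tau)}U_{(\rho,\tau)}(X,Y)$. Auxiliary variables: let $\mathfrak{u}:\mathcal{X}_n\times\mathcal{X}_n\to\mathbb{Z}$ and $\mathfrak{v}:\mathcal{X}_n\times\mathcal{X}_n\to\mathbb{Z}^d$ be functions, $U:=\mathfrak{u}(Z)$, $V:=\mathfrak{v}(Z)$. Let $\mathcal{S}_n,\mathcal{S}_n^U,\mathcal{S}_n^V$ be the supports (sets of values taken with positive probability) of $(U,V)$, $U$, $V$ respectively. For $v\in\mathcal{S}_n^V$ let $\mathcal{S}_n(v):=\{u\in\mathcal{S}_n^U:(u,v)\in\mathcal{S}_n\}$. For $(u,v)\in\mathcal{S}_n$ let $l(u,v):=E[L(Z)\mid U=u,V=v]$. For $v\in\mathcal{S}_n^V$,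 $U_{(v)}$ denotes a random variable with $P(U_{(v)}=z)=P(U=z\mid V=v)$ for all $z\in\mathbb{Z}$. $\mathrm{Var}[U_{(v)}|U_{(v)}\in B]$ is the variance of $U_{(v)}$ under the conditional law given the event $\{U_{(v)}\in B\}$. *)

(* Defs.v *)
From mathcomp Require Import all_boot all_order all_algebra.
From mathcomp Require Import all_classical all_reals all_analysis.

Set Implicit Arguments.
Unset Strict Implicit.
Unset Printing Implicit Defensive.

Import Order.TTheory GRing.Theory Num.Theory.

Local Open Scope classical_set_scope.
Local Open Scope ring_scope.

Section Alignment.
Context {A : finType} {R : realType} (n : nat).
Variables (S : A -> A -> R) (gamma : R).

Definition increasing k (r : k.-tuple 'I_n) : bool :=
  sorted ltn [seq nat_of_ord i | i <- r].

Definition align_score k (rho tau : k.-tuple 'I_n) (x y : n.-tuple A) : R :=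
  \sum_(i < k) S (tnth x (tnth rho i)) (tnth y (tnth tau i))
  + gamma * (n%:R - k%:R).

(* Scores may be negative, so the iterated maximum starts from the score of the
   empty alignment, which is itself one of the candidates (k = 0). *)
Definition opt_score (x y : n.-tuple A) : R :=
  \big[Num.max/align_score [tuple] [tuple] x y]_(k < n.+1)
    \big[Num.max/align_score [tuple] [tuple] x y]_(
      rt : k.-tuple 'I_n * k.-tuple 'I_n | increasing rt.1 && increasing rt.2)
      align_score rt.1 rt.2 x y.

End Alignment.

Section DiscreteVariables.
Context {d : measure_display} {T : measurableType d} {R : realType}.
Variable P : probability T R.

(* Random element of a set carrying the discrete sigma-algebra. *)
Definition discrete_rv {E : Type} (X : T -> E) : Prop :=
  forall B : set E, measurable (X @^-1` B).

Definition independent_rv {E F : Type} (X : T -> E) (Y : T -> F) : Prop :=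
  forall (B : set E) (C : set F),
    P (X @^-1` B `&` Y @^-1` C) = (P (X @^-1` B) * P (Y @^-1` C))%E.

Definition same_law {E : Type} (X Y : T -> E) : Prop :=
  forall B : set E, P (X @^-1` B) = P (Y @^-1` B).

Definition supp {E : Type} (X : T -> E) : set E :=
  [set x | (0 < P (X @^-1` [set x]))%E].

(* The conditional probability P(. | B); see condPE. It is P itself when B is
   not measurable or has probability 0. *)
Definition condP (B : set T) : probability T R :=
  match pselect (measurable B) with
  | left mB => mnormalize (mrestr P mB) P
  | right _ => P
  end.

Lemma condPE (B : set T) : measurable B -> (0 < P B)%E ->
  forall C : set T, condP B C = (P (C `&` B) * (fine (P B))^-1%:E)%E.
Proof.
move=> mB PB0 C; rewrite /condP; case: pselect => // mB'.
rewrite /= /mnormalize /= /mrestr setTI.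
rewrite (gt_eqF PB0) /=.
have: (P B < +oo)%E by apply: (le_lt_trans (probability_le1 P mB)); rewrite ltry.
by rewrite lt_neqAle => /andP[/negPf -> _].
Qed.

End DiscreteVariables.

Section AuxiliaryVariables.
Context {d : measure_display} {T : measurableType d} {R : realType}.
Variable P : probability T R.
Context {m : nat} (U : T -> int) (V : T -> 'rV[int]_m).

(* The set S_n(v). *)
Definition supp_at (v : 'rV[int]_m) : set int :=
  [set u | supp P U u /\ supp P (fun w => (U w, V w)) (u, v)].

(* l(u, v) = E[L | U = u, V = v]. *)
Definition cond_mean (L : T -> R) (u : int) (v : 'rV[int]_m) : \bar R :=
  ('E_(condP P [set w | U w = u /\ V w = v])[L])%E.

(* U_(v), whose law is that of U given V = v, is realised as U itself on the
   probability space (T, P(. | V = v)). *)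
Definition P_at (v : 'rV[int]_m) : probability T R := condP P (V @^-1` [set v]).

(* P(U_(v) \in B) *)
Definition prob_at (v : 'rV[int]_m) (B : set int) : \bar R :=
  P_at v (U @^-1` B).

(* Var[U_(v) | U_(v) \in B] *)
Definition cond_var_at (v : 'rV[int]_m) (B : set int) : \bar R :=
  ('V_(condP (P_at v) (U @^-1` B))[fun w => (U w)%:~R])%E.

End AuxiliaryVariables.

(* Main.v *)
Require Import Defs.
From mathcomp Require Import all_boot all_order all_algebra.
From mathcomp Require Import all_classical all_reals all_analysis.
From mathcomp Require Import zify ring lra.

Set Implicit Arguments.
Unset Strict Implicit.
Unset Printing Implicit Defensive.

Import Order.TTheory GRing.Theory Num.Theory.

Local Open Scope classical_set_scope.
Local Open Scope ring_scope.

(** Write [Z] for the pair of random words, [g Z] for the optimal score and [mu]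
    for its mean.  The pair ranges over a finite type, so every probability,
    conditional mean and variance is a finite sum with the weights
    [mass P Z z = P (Z = z)], and the statement is about such sums.

    The variance of the score is the sum of [mass z * (g z - mu)^2] over all
    [z].  The cells [{V = v, U in Un v}], for [v] in [Vn], are disjoint, so the
    other terms may be dropped and each cell treated alone.  In one cell, let
    [h u] be the mean of the score given [U = u] and [V = v].

    - Replacing [g] by [h (U)] lowers the sum of squares, because [g - h (U)]
      is orthogonal to every function of [U] ([sum_fiberwise0]).
    - Between two neighbouring elements of [Un v], at most [ko] apart, [h] grows
      by at least [delta]; chaining neighbours gives
      [h y - h x >= (delta / ko) * (y - x)] for all [x < y] in [Un v]
      ([expansive_of_gaps]).
    - Thus the inverse of [h] is Lipschitz with constant [ko / delta], and it
      extends to the point [mu] with the same constant: some [c] satisfies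
      [|h u - mu| >= (delta / ko) * |u - c|] for all [u] in [Un v]
      ([crossing_point]).

    Together, the cell contributes at least [(delta / ko)^2] times the scatter
    of [U] about [c] ([fiber_mean_scatter]).  The scatter about any point is at
    least the probability of the cell times the conditional variance of [U],
    hence at least that probability times [psi] ([cell_scatter_ge]).  The sum
    over [v] is the theorem. *)

(** * Weighted sums over a finite type *)

(** The fibres of [k] are indexed by canonical representatives of their
    elements, because [K] need not be finite. *)
Lemma sum_fiberwise0 (R : nzRingType) (F : finType) (K : eqType) (k : F -> K)
    (D : pred F) (e : F -> R) (phi : K -> R) :
  (forall y, D y -> \sum_(z | D z && (k z == k y)) e z = 0) ->
  \sum_(z | D z) e z * phi (k z) = 0.
Proof.
move=> e0; pose r z := choose (fun y => k y == k z) z.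
have kr z : k (r z) = k z by apply/eqP/(@chooseP _ (fun y => k y == k z)).
have rk z y : k z = k y -> r z = r y.
  by move=> kzy; rewrite /r kzy; apply: choose_id; rewrite ?kzy eqxx.
rewrite (partition_big r xpredT) //= big1// => j _.
have [y /andP[Dy /eqP ryj]|Dj] := pickP (fun y => D y && (r y == j));
  last by rewrite big_pred0.
rewrite (eq_big (fun z => D z && (k z == k y)) (fun z => e z * phi (k y))).
- by rewrite -mulr_suml e0// mul0r.
- move=> z; case: (D z) => //=; apply/eqP/eqP => [rzj|/rk ->//].
  by rewrite -(kr z) -(kr y) rzj ryj.
- by move=> z /andP[_ /eqP rzj]; rewrite -(kr z) -(kr y) rzj ryj.
Qed.

(** One-point extension of a Lipschitz map: the relation [f z |-> x z] is
    [1/a]-Lipschitz, and [c] is a value for it at [mu].  The admissible [c] for a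
    given [z] form the interval centred at [x z] of radius [|f z - mu| / a].
    These intervals meet pairwise, so the largest left end point lies in all of
    them. *)
Lemma crossing_point (R : realFieldType) (F : finType) (D : pred F)
    (x f : F -> R) (a mu : R) :
  0 < a ->
  (forall z y, D z -> D y -> a * `|x z - x y| <= `|f z - f y|) ->
  exists c, forall z, D z -> a * `|x z - c| <= `|f z - mu|.
Proof.
move=> a0 xf; have [/existsP[z0 Dz0]|/existsPn D0] := boolP [exists z, D z];
    last by exists 0 => z Dz; have := D0 z; rewrite Dz.
case: (@arg_maxP _ _ _ z0 D (fun z => x z - `|f z - mu| / a) Dz0) => y Dy ymax.
exists (x y - `|f y - mu| / a) => z Dz.
have le1 : x z - `|f z - mu| / a <= x y - `|f y - mu| / a := ymax z Dz.
have le2 : x y - x z <= (`|f z - mu| + `|f y - mu|) / a.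
  rewrite ler_pdivlMr// mulrC; apply: le_trans (_ : `|f y - f z| <= _).
    by apply: le_trans (xf _ _ Dy Dz); rewrite ler_pM2l// ler_norm.
  have -> : f y - f z = (f y - mu) - (f z - mu) by ring.
  by rewrite [leRHS]addrC ler_normB.
rewrite mulrC -ler_pdivlMr// ler_norml; rewrite mulrDl in le2.
by apply/andP; split; lra.
Qed.

(** Here [h] lists the means of [g] on the fibres of [u].  By Pythagoras the
    scatter of [g] about [mu] is at least that of [h \o u], which the
    expansiveness of [h] compares with the scatter of [u] about the crossing
    point. *)
Lemma fiber_mean_scatter (R : realFieldType) (F : finType) (D : pred F)
    (p g : F -> R) (u : F -> int) (h : int -> R) (a mu : R) :
  0 < a -> (forall z, 0 <= p z) ->
  (forall y, D y -> \sum_(z | D z && (u z == u y)) p z * g z =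
                    h (u y) * \sum_(z | D z && (u z == u y)) p z) ->
  (forall z y, D z -> D y -> u z < u y ->
     a * ((u y)%:~R - (u z)%:~R) <= h (u y) - h (u z)) ->
  exists c, a ^+ 2 * \sum_(z | D z) p z * ((u z)%:~R - c) ^+ 2 <=
            \sum_(z | D z) p z * (g z - mu) ^+ 2.
Proof.
move=> a0 p0 hmean hinc.
have [|c hc] := @crossing_point R F D (fun z => (u z)%:~R) (h \o u) a mu a0.
  move=> z y Dz Dy /=.
  wlog le_zy : z y Dz Dy / u z <= u y => [sym|].
    have [le_zy|/ltW le_yz] := leP (u z) (u y); first exact: sym.
    by rewrite distrC [leRHS]distrC; exact: sym.
  move: le_zy; rewrite le_eqVlt => /predU1P[->|lt_zy].
    by rewrite !subrr normr0 mulr0.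
  rewrite ler0_norm; last by rewrite subr_le0 ler_int ltW.
  rewrite opprB.
  by apply: (le_trans (hinc _ _ Dz Dy lt_zy)); rewrite distrC ler_norm.
exists c.
(* The cross term of the square of [(g - h) + (h - mu)]. *)
have orth : \sum_(z | D z) p z * (g z - h (u z)) * (h (u z) - mu) = 0.
  apply: (@sum_fiberwise0 _ _ _ u D (fun z => p z * (g z - h (u z)))
            (fun k => h k - mu)) => y Dy.
  rewrite (eq_bigr (fun z => p z * g z - h (u y) * p z)); last first.
    by move=> z /andP[_ /eqP ->]; ring.
  by rewrite sumrB -mulr_sumr hmean// subrr.
have -> : \sum_(z | D z) p z * (g z - mu) ^+ 2 =
    \sum_(z | D z) (p z * (g z - h (u z)) ^+ 2 + p z * (h (u z) - mu) ^+ 2).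
  rewrite -[RHS]addr0 -[X in _ = _ + X](mulr0 2) -[X in 2 * X]orth.
  rewrite [X in _ + X]mulr_sumr -[RHS]big_split /=.
  by apply: eq_bigr => z _; ring.
rewrite mulr_sumr; apply: ler_sum => z Dz.
have hcz : a ^+ 2 * ((u z)%:~R - c) ^+ 2 <= (h (u z) - mu) ^+ 2.
  rewrite -[leRHS]real_normK ?num_real// -[X in _ * X]real_normK ?num_real//.
  by rewrite -exprMn lerXn2r ?nnegrE ?mulr_ge0 ?(ltW a0)//; exact: hc.
rewrite mulrCA; apply: (le_trans (ler_wpM2l (p0 z) hcz)).
by rewrite lerDr mulr_ge0// sqr_ge0.
Qed.

(** A step of length at most [k] raises [h] by at least [delta], hence by at
    least [delta / k] times its length; consecutive elements of [B] link any two
    of its points by such steps. *)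
Lemma expansive_of_gaps (R : realFieldType) (B : set int) (h : int -> R)
    (delta : R) (k : nat) :
  0 < delta -> (1 <= k)%N ->
  (forall x y, B x -> B y -> x < y -> delta <= h y - h x) ->
  (forall x, B x -> (exists y, B y /\ x < y) ->
     exists y, [/\ B y, x < y & y <= x + k%:Z]) ->
  forall x y, B x -> B y -> x < y ->
    delta / k%:R * (y%:~R - x%:~R) <= h y - h x.
Proof.
move=> d0 k0 hinc hgap x y Bx By.
have kR : (0 : R) < k%:R by rewrite ltr0n.
have step s t : B s -> B t -> s < t -> t <= s + k%:Z ->
    delta / k%:R * (t%:~R - s%:~R) <= h t - h s.
  move=> Bs Bt st tsk; apply: le_trans (hinc s t Bs Bt st).
  rewrite -mulrA ger_pMr// mulrC ler_pdivrMr// mul1r lerBlDl.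
  by rewrite [k%:R]pmulrn -intrD ler_int.
have [n] := ubnP `|y - x|%N; elim: n x Bx => // n IHn x Bx lt_n xy.
have [t [Bt xt tk]] := hgap x Bx (ex_intro _ y (conj By xy)).
have [ty|yt] := ltP t y; last by apply: step => //; exact: le_trans tk.
have := step _ _ Bx Bt xt tk.
have lt_n' : (`|y - t| < n)%N.
  rewrite -ltz_nat gez0_abs ?subr_ge0 ?ltW//.
  move: lt_n; rewrite -ltz_nat gez0_abs ?subr_ge0 ?ltW//; lia.
have := IHn t Bt lt_n' ty.
set b := delta / _; nra.
Qed.
(** * Random variables with values in a finite type *)
Section FiniteValued.
Context {d : measure_display} {T : measurableType d} {R : realType}.
Implicit Types (P : probability T R) (A B C : set T).

Lemma discrete_rv_pair (E F : finType) (X : T -> E) (Y : T -> F) :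
  discrete_rv X -> discrete_rv Y -> discrete_rv (fun w => (X w, Y w)).
Proof.
move=> mX mY B.
rewrite (_ : _ @^-1` B = \bigcup_(z in B) (X @^-1` [set z.1] `&` Y @^-1` [set z.2])).
  by apply: fin_bigcup_measurable => // z _; exact: measurableI.
apply/seteqP; split=> [w Bw|w [[x y] Bz] [/= Xx Yy]]; first by exists (X w, Y w).
by rewrite /preimage /= Xx Yy.
Qed.

Definition mass (F : finType) P (Z : T -> F) z : R := fine (P (Z @^-1` [set z])).

Lemma mass_ge0 (F : finType) P (Z : T -> F) z : 0 <= mass P Z z.
Proof. exact: fine_ge0. Qed.

Lemma expectation_mass (F : finType) P (Z : T -> F) (f : F -> R) :
  discrete_rv Z -> 'E_P[fun w => f (Z w)]%E = (\sum_z mass P Z z * f z)%:E.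
Proof.
move=> mZ; rewrite unlock.
transitivity (\int[P]_w \sum_z ((f z)%:E * (\1_(Z @^-1` [set z]) w)%:E))%E.
  apply: eq_integral => w _; rewrite (bigD1 (Z w))//= big1 ?adde0.
    by rewrite indicE mem_set// mule1.
  by move=> z /eqP zw; rewrite indicE memNset ?mule0//= => /esym.
rewrite integral_sum//; last first.
  by move=> z; apply/integrableZl => //; exact/integrable_indic.
rewrite -sumEFin; apply: eq_bigr => z _.
rewrite integralZl//; last exact/integrable_indic.
by rewrite integral_indic// setIT mulrC EFinM fineK// fin_num_measure.
Qed.

Lemma prob_mass (F : finType) P (Z : T -> F) (B : set F) :
  discrete_rv Z -> P (Z @^-1` B) = (\sum_(z | z \in B) mass P Z z)%:E.
Proof.
move=> mZ; rewrite -expectation_indic//.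
rewrite (_ : \1_(Z @^-1` B) = fun w => \1_B (Z w)); last first.
  by apply/funext => w; rewrite !indicE.
rewrite (expectation_mass _ _ mZ) [in RHS]big_mkcond; congr _%:E.
by apply: eq_bigr => z _; rewrite indicE; case: ifP; rewrite ?mulr1 ?mulr0.
Qed.

Lemma sum_mass (F : finType) P (Z : T -> F) :
  discrete_rv Z -> \sum_z mass P Z z = 1.
Proof.
move=> mZ; have /esym := prob_mass P setT mZ.
rewrite preimage_setT probability_setT => -[sumT].
by apply: etrans sumT; apply: eq_bigl => z; rewrite mem_set.
Qed.

Lemma variance_mass (F : finType) P (Z : T -> F) (f : F -> R) :
  discrete_rv Z -> exists mu,
  'V_P[fun w => f (Z w)]%E = (\sum_z mass P Z z * (f z - mu) ^+ 2)%:E.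
Proof.
move=> mZ; exists (fine 'E_P[fun w => f (Z w)]); rewrite /variance unlock.
set mu := fine _.
exact: (expectation_mass P (fun z => (f z - mu) * (f z - mu)) mZ).
Qed.

(** The mean is the point about which the scatter is least. *)
Lemma variance_mass_le (F : finType) P (Z : T -> F) (f : F -> R) (c : R) :
  discrete_rv Z ->
  ('V_P[fun w => f (Z w)] <= (\sum_z mass P Z z * (f z - c) ^+ 2)%:E)%E.
Proof.
move=> mZ; rewrite /variance unlock (expectation_mass P f mZ) /=.
set m := \sum_z _.
have /= -> := expectation_mass P (fun z => (f z - m) * (f z - m)) mZ.
rewrite lee_fin.
rewrite -subr_ge0 -sumrB (eq_bigr (fun z =>
  2 * (m - c) * (mass P Z z * f z) + (c ^+ 2 - m ^+ 2) * mass P Z z)); last first.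
  by move=> z _; rewrite /=; ring.
rewrite big_split /= -!mulr_sumr sum_mass// -/m mulr1.
have -> : 2 * (m - c) * m + (c ^+ 2 - m ^+ 2) = (m - c) ^+ 2 by ring.
exact: sqr_ge0.
Qed.

(** Conditioning twice is conditioning on the intersection; this turns the law
    of [U_(v)] given [U_(v) \in B] into the law of [U] given one event of [P]. *)
Lemma condP_condP P A B C : measurable A -> measurable B -> measurable C ->
  (0 < P (A `&` B))%E ->
  condP (condP P A) B C = condP P (A `&` B) C.
Proof.
move=> mA mB mC AB0.
have mAB : measurable (A `&` B) by exact: measurableI.
have A0 : (0 < P A)%E.
  by apply: lt_le_trans AB0 _; apply: le_measure; rewrite ?inE.
have fA0 : 0 < fine (P A) by rewrite fine_gt0// A0 ltey_eq fin_num_measure.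
have fAB0 : 0 < fine (P (A `&` B)).
  by rewrite fine_gt0// AB0 ltey_eq fin_num_measure.
have cB : condP P A B = (fine (P (A `&` B)) / fine (P A))%:E.
  by rewrite condPE// setIC EFinM fineK// fin_num_measure.
rewrite condPE ?cB ?lte_fin ?divr_gt0//= !condPE//.
rewrite -setIA [B `&` A]setIC -muleA -EFinM; congr (_ * _%:E)%E.
by field; rewrite !gt_eqF.
Qed.

Lemma mass_condP (F : finType) P (Z : T -> F) (B : set F) z :
  discrete_rv Z -> (0 < P (Z @^-1` B))%E ->
  mass (condP P (Z @^-1` B)) Z z =
  (if z \in B then mass P Z z else 0) / \sum_(y | y \in B) mass P Z y.
Proof.
move=> mZ B0; rewrite /mass condPE// -preimage_setI (prob_mass _ B mZ) /=.
have [zB|zB] := boolP (z \in B).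
  rewrite (_ : [set z] `&` B = [set z]) ?fineM ?fin_num_measure//.
  by apply/setIidPl => _ /= ->; exact: set_mem.
rewrite (_ : [set z] `&` B = set0) ?preimage_set0 ?measure0 ?mul0e ?mul0r//.
by rewrite -subset0 => _ [/= -> zB']; move: zB; rewrite mem_set.
Qed.

End FiniteValued.

(** * The contribution of one value of V *)
Section OneValueOfV.
Context {d : measure_display} {T : measurableType d} {R : realType}.
Context {F : finType} {m : nat}.
Context (P : probability T R) (Z : T -> F).
Context (uf : F -> int) (vf : F -> 'rV[int]_m).
Context (mZ : discrete_rv Z).

Let U w := uf (Z w).
Let V w := vf (Z w).

Let mU B : measurable (U @^-1` B).
Proof. exact: (mZ (uf @^-1` B)). Qed.

Let mV B : measurable (V @^-1` B).
Proof. exact: (mZ (vf @^-1` B)). Qed.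

Definition cell (v : 'rV[int]_m) (B : set int) : set F :=
  [set z | vf z = v /\ B (uf z)].

Lemma prob_at_mass v B : supp P V v ->
  (prob_at P U V v B * P (V @^-1` [set v]))%E =
  (\sum_(z | z \in cell v B) mass P Z z)%:E.
Proof.
move=> v0; have V0 : 0 < fine (P (V @^-1` [set v])).
  by rewrite fine_gt0// v0 ltey_eq fin_num_measure.
rewrite /prob_at /P_at condPE//.
rewrite -[X in (_ * X)%E]fineK ?fin_num_measure//.
rewrite -muleA -EFinM mulVf ?gt_eqF// mule1 -prob_mass//; congr (P _).
by apply/seteqP; split=> [w [? ?]|w [? ?]].
Qed.

(** The conditional mean as a real number, in the product form that
    [fiber_mean_scatter] expects of fibre means. *)
Lemma cond_mean_mass (g : F -> R) u v :
  (0 < P (Z @^-1` [set z | uf z = u /\ vf z = v]))%E ->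
  exists l, cond_mean P U V (g \o Z) u v = l%:E /\
    \sum_(z | (vf z == v) && (uf z == u)) mass P Z z * g z =
    l * \sum_(z | (vf z == v) && (uf z == u)) mass P Z z.
Proof.
set C := [set z | _] => C0.
have inC z : (z \in C) = (vf z == v) && (uf z == u).
  apply/idP/andP => [/set_mem[<- <-]|[/eqP vz /eqP uz]]; first by rewrite !eqxx.
  by rewrite mem_set.
have Ep := prob_mass P C mZ; rewrite -(eq_bigl _ _ inC).
rewrite Ep lte_fin in C0.
exists ((\sum_(z | z \in C) mass P Z z * g z) / \sum_(z | z \in C) mass P Z z).
split; last by rewrite -(eq_bigl _ _ inC) divfK ?gt_eqF.
rewrite /cond_mean (_ : [set w | _] = Z @^-1` C)// (expectation_mass _ g mZ).
rewrite mulr_suml [in RHS]big_mkcond; congr _%:E; apply: eq_bigr => z _.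
rewrite mass_condP// ?Ep ?lte_fin//.
by case: ifP => _; rewrite ?mul0r// mulrAC.
Qed.

Lemma cond_var_at_le v B (c : R) : (0 < P (Z @^-1` cell v B))%E ->
  (cond_var_at P U V v B <=
   ((\sum_(z | z \in cell v B) mass P Z z * ((uf z)%:~R - c) ^+ 2) /
    \sum_(z | z \in cell v B) mass P Z z)%:E)%E.
Proof.
move=> C0; have Ep := prob_mass P (cell v B) mZ.
rewrite /cond_var_at /P_at.
apply: (le_trans (variance_mass_le _ (fun z => (uf z)%:~R) c mZ)).
rewrite lee_fin mulr_suml [leRHS]big_mkcond /=; apply: ler_sum => z _.
rewrite /mass condP_condP//; [|exact: mZ..].
rewrite -/(mass _ _ _) (_ : _ `&` _ = Z @^-1` cell v B); last first.
  by apply/seteqP; split=> [w [? ?]|w [? ?]].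
rewrite mass_condP//.
by case: ifP => _; rewrite ?mul0r// mulrAC.
Qed.

(** Whatever [mu] is, the scatter of [g] about it on the cell dominates the
    conditional variance of [U], because the latter is bounded by the scatter of
    [U] about the crossing point that [mu] determines. *)
Lemma cell_scatter_ge (g : F -> R) v (B : set int) (delta : R) (ko : nat)
    (psi mu : R) :
  B !=set0 -> B `<=` supp_at P U V v -> 0 < delta -> (1 <= ko)%N ->
  (forall u1 u2, B u1 -> B u2 -> u1 < u2 ->
     (delta%:E <= cond_mean P U V (g \o Z) u2 v -
                  cond_mean P U V (g \o Z) u1 v)%E) ->
  (psi%:E <= cond_var_at P U V v B)%E ->
  (forall u1, B u1 -> (exists u, B u /\ u1 < u) ->
     exists u2, [/\ B u2, u1 < u2 & u2 <= u1 + ko%:Z]) ->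
  (delta / ko%:R) ^+ 2 * psi * (\sum_(z | z \in cell v B) mass P Z z) <=
  \sum_(z | z \in cell v B) mass P Z z * (g z - mu) ^+ 2.
Proof.
move=> [u0 Bu0] Bsupp d0 k0 hinc hvar hgap.
have fib0 u : B u -> (0 < P (Z @^-1` [set z | uf z = u /\ vf z = v]))%E.
  move=> /Bsupp[_]; rewrite /supp /=.
  rewrite (_ : _ @^-1` _ = Z @^-1` [set z | uf z = u /\ vf z = v])//.
  apply/seteqP; split=> [w [<- <-]//|w [uw vw]].
  by rewrite /preimage /= /U /V uw vw.
have C0 : (0 < P (Z @^-1` cell v B))%E.
  apply: lt_le_trans (fib0 _ Bu0) _.
  apply: le_measure; rewrite ?inE; [exact: mZ..|].
  by move=> w [/= uw vw]; split=> //; rewrite uw.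
have q0 : 0 < \sum_(z | z \in cell v B) mass P Z z.
  by rewrite -lte_fin -prob_mass.
pose h u := fine (cond_mean P U V (g \o Z) u v).
have a0 : 0 < delta / ko%:R by rewrite divr_gt0// ltr0n.
have hB := @expansive_of_gaps R B h delta ko d0 k0.
have {}hB := hB _ hgap.
have [|||c hc] := @fiber_mean_scatter R F [pred z | z \in cell v B] (mass P Z) g uf h
  (delta / ko%:R) mu a0.
- exact: mass_ge0.
- move=> y /set_mem[vy By].
  have [l [El hl]] := cond_mean_mass g (fib0 _ By).
  have inC z : (z \in cell v B) && (uf z == uf y) = (vf z == v) && (uf z == uf y).
    apply/andP/andP => [[/set_mem[-> _] ->]|[/eqP vz /eqP uz]]; first by rewrite eqxx.
    by rewrite uz eqxx; split=> //; apply: mem_set; split=> //; rewrite uz.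
  by rewrite !(eq_bigl _ _ inC) /h El.
- move=> z y /set_mem[_ Bz] /set_mem[_ By]; apply: hB => //.
  move=> x1 x2 B1 B2 x12; have := hinc _ _ B1 B2 x12; rewrite /h.
  have [l1 [-> _]] := cond_mean_mass g (fib0 _ B1).
  by have [l2 [-> _]] := cond_mean_mass g (fib0 _ B2).
apply: le_trans hc; rewrite -mulrA ler_wpM2l ?sqr_ge0//.
rewrite -ler_pdivlMr// -lee_fin; exact: le_trans hvar (cond_var_at_le c C0).
Qed.

End OneValueOfV.

(** * The variance of the optimal score *)
Theorem theorem2p1
  (R : realType) (A : finType) (n : nat) (hn : (1 <= n)%N)
  (Xn : {set n.-tuple A})
  (disp : measure_display) (T : measurableType disp) (P : probability T R)
  (X Y : T -> {x : n.-tuple A | x \in Xn})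
  (hX : discrete_rv X) (hY : discrete_rv Y)
  (hindep : independent_rv P X Y) (hlaw : same_law P X Y)
  (S : A -> A -> R) (hS : forall a b : A, 0 <= S a b) (gamma : R)
  (d : nat)
  (uf : {x : n.-tuple A | x \in Xn} * {x : n.-tuple A | x \in Xn} -> int)
  (vf : {x : n.-tuple A | x \in Xn} * {x : n.-tuple A | x \in Xn} ->
        'rV[int]_d) :
  let Z := fun w : T => (X w, Y w) in
  let L := fun w : T => opt_score S gamma (val (Z w).1) (val (Z w).2) in
  let U := fun w : T => uf (Z w) in
  let V := fun w : T => vf (Z w) in
  forall (Vn : set 'rV[int]_d) (Un : 'rV[int]_d -> set int)
    (delta : R) (ko : nat) (psi : R),
  Vn `<=` supp P V ->
  (forall v, Vn v -> Un v !=set0 /\ Un v `<=` supp_at P U V v) ->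
  0 < delta ->
  (1 <= ko)%N ->
  (forall v, Vn v -> forall u1 u2 : int, Un v u1 -> Un v u2 -> u1 < u2 ->
     (delta%:E <= cond_mean P U V L u2 v - cond_mean P U V L u1 v)%E) ->
  (forall v, Vn v -> (psi%:E <= cond_var_at P U V v (Un v))%E) ->
  (forall v, Vn v -> forall u1 : int, Un v u1 ->
     (exists u : int, Un v u /\ u1 < u) ->
     exists u2 : int, [/\ Un v u2, u1 < u2 & u2 <= u1 + ko%:Z]) ->
  (((delta / ko%:R) ^+ 2 * psi)%:E *
     (\sum_(v \in Vn) prob_at P U V v (Un v) * P (V @^-1` [set v]))
   <= 'V_P[L])%E.
Proof.
move=> Z L U V Vn Un delta ko psi VnS UnS d0 k0 hinc hvar hgap.
have mZ : discrete_rv Z by exact: discrete_rv_pair.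
pose g (z : {x | x \in Xn} * {x | x \in Xn}) := opt_score S gamma (val z.1) (val z.2).
have [mu ->] := variance_mass P g mZ.
have VnF v : Vn v -> exists z, vf z = v.
  move=> /VnS; rewrite /supp /= => v0; apply: contrapT => nv.
  move: v0; rewrite (_ : V @^-1` [set v] = set0) ?measure0 ?ltxx//.
  by rewrite -subset0 => w /= vw; apply: nv; exists (Z w).
(* Only finitely many values of [V] are taken, so the sum over [Vn] is a sum
   over a duplicate-free sequence. *)
pose r := [seq v <- undup (codom vf) | v \in Vn].
have ur : uniq r by rewrite filter_uniq ?undup_uniq.
have inr v : (v \in r) = (v \in Vn).
  rewrite mem_filter mem_undup andb_idr// => /set_mem/VnF[z <-].
  exact: codom_f.
rewrite (@fsbigE _ _ _ _ _ r)//; last 2 first.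
- by move=> v /=; rewrite inr => /set_mem.
- by move=> v Vnv; rewrite inr mem_set.
rewrite (eq_bigr (fun v =>
    (\sum_(z | z \in cell uf vf v (Un v)) mass P Z z)%:E)); last first.
  by move=> v /set_mem/VnS; exact: prob_at_mass.
rewrite sumEFin -EFinM lee_fin mulr_sumr.
apply: (@le_trans _ _ (\sum_(v <- r | v \in Vn)
    \sum_(z | z \in cell uf vf v (Un v)) mass P Z z * (g z - mu) ^+ 2)).
  apply: ler_sum => v /set_mem Vnv; have [Un0 Usub] := UnS v Vnv.
  by apply: cell_scatter_ge; rewrite //; [exact: hinc|exact: hvar|exact: hgap].
under eq_bigr do rewrite big_mkcond.
rewrite exchange_big /=; apply: ler_sum => z _.
have e0 : 0 <= mass P Z z * (g z - mu) ^+ 2 by rewrite mulr_ge0 ?mass_ge0 ?sqr_ge0.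
(* The cells are disjoint: [z] lies in none but that of [vf z]. *)
have far v : v != vf z -> (z \in cell uf vf v (Un v)) = false.
  by move=> vz; apply/negbTE/negP => /set_mem[/esym/eqP]; rewrite (negbTE vz).
rewrite big_mkcond; have [zr|zr] := boolP (vf z \in r).
  rewrite (bigD1_seq (vf z))//= big1 ?addr0 => [|v vz]; last by rewrite far ?if_same.
  by case: (_ \in Vn); [case: ifP|].
rewrite big_seq big1// => v vr; rewrite far ?if_same//.
by apply: contraNneq zr => <-.
Qed.
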